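(* Let $h_i^{\mathrm U}, h_j^{\mathrm D}>0$, $h_{ij}\ge 0$, $\chi\ge 0$, $W>0$, $\omega>0$, $P_{\mathrm{fix}}>0$ satisfy $h_{ij}(1+\chi)<\min(h_i^{\mathrm U},h_j^{\mathrm D})$. For $R_{\mathrm{tot}}\ge 0$ define the maximum energy efficiency $$\beta_{\mathrm{EE}}^{*}(R_{\mathrm{tot}})=\max\ \frac{R_{\mathrm{tot}}}{\omega\,(p^{\mathrm U}+p^{\mathrm D})+P_{\mathrm{fix}}},$$ where the maximum is over all $p^{\mathrm U},p^{\mathrm D}\ge 0$ with $$W\log_2\left(1+\frac{p^{\mathrm U}h_i^{\mathrm U}}{1+\chi}\right)+W\log_2\left(1+\frac{p^{\mathrm D}h_j^{\mathrm D}}{1+p^{\mathrm U}h_{ij}}\right)=R_{\mathrm{tot}}.$$ Then $\beta_{\mathrm{EE}}^{*}$ is a quasi-concave function of the spectral efficiency $\beta_{\mathrm{SE}}=R_{\mathrm{tot}}/W\in[0,\infty)$.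
   Context: This describes a full-duplex base station serving a single paired uplink user $i$ and downlink user $j$: $h_i^{\mathrm U}$, $h_j^{\mathrm D}$, $h_{ij}$ are the uplink, downlink and co-channel-interference carrier-to-noise ratios, $\chi$ is the normalized residual self-interference power, $W$ is the bandwidth, $p^{\mathrm U},p^{\mathrm D}$ are the uplink and downlink transmit powers, $\omega$ is the inverse power amplifier efficiency, and $P_{\mathrm{fix}}$ is the fixed circuit power. A function on a convex set is quasi-concave if all its superlevel sets $\{x: f(x)\ge\alpha\}$, $\alpha\in\mathbb{R}$, are convex. *)

(* Defs.v *)
From HB Require Import structures.
From mathcomp Require Import all_boot all_order all_algebra.
From mathcomp Require Import all_classical all_reals all_analysis.

Set Implicit Arguments.
Unset Strict Implicit.
Unset Printing Implicit Defensive.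

Import Order.TTheory GRing.Theory Num.Theory.
Import numFieldNormedType.Exports.

Local Open Scope classical_set_scope.
Local Open Scope ring_scope.

Definition log2 (R : realType) (x : R) : R := ln x / ln 2.

Definition is_max (R : realType) (A : set R) (m : R) : Prop :=
  A m /\ ubound A m.

Definition quasi_concave (R : realType) (E : lmodType R) (D : set E)
    (f : E -> R) : Prop :=
  forall alpha : R,
    convex_set ([set x | D x /\ alpha <= f x] : set (convex_lmodType E)).

Section FullDuplexPair.
Variables (R : realType).
(* Carrier-to-noise ratios of the uplink, the downlink and the co-channel
   interference link; residual self-interference; bandwidth; inverse amplifier
   efficiency; fixed circuit power. *)
Variables (hU hD hUD chi W omega Pfix : R).

Definition rateU (pU : R) : R := W * log2 (1 + pU * hU / (1 + chi)).

Definition rateD (pU pD : R) : R := W * log2 (1 + pD * hD / (1 + pU * hUD)).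

Definition feasible (Rtot : R) : set (R * R) :=
  [set p | [/\ 0 <= p.1, 0 <= p.2 & rateU p.1 + rateD p.1 p.2 = Rtot]].

Definition EE (Rtot : R) (p : R * R) : R :=
  Rtot / (omega * (p.1 + p.2) + Pfix).

Definition EE_values (Rtot : R) : set R := EE Rtot @` feasible Rtot.

(* [sup] is a junk value on unbounded or empty sets, and need not be attained
   in general, so that this is a maximum has to be asserted separately. *)
Definition max_EE (Rtot : R) : R := sup (EE_values Rtot).

End FullDuplexPair.

(* Main.v *)
Require Import Defs.
From HB Require Import structures.
From mathcomp Require Import all_boot all_order all_algebra.
From mathcomp Require Import all_classical all_reals all_analysis.
From mathcomp Require Import ring.
Set Implicit Arguments.
Unset Strict Implicit.
Unset Printing Implicit Defensive.
Import Order.TTheory GRing.Theory Num.Theory.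
Import numFieldNormedType.Exports.
Local Open Scope classical_set_scope.
Local Open Scope ring_scope.

(** Let [a = hU / (1 + chi)], [b = hD], [c = hUD], and let [s] and [t] be
    [ln 2 / W] times the uplink rate and the total rate. The feasible pairs of
    powers of total rate [t] are parametrized by [0 <= s <= t], and
      [pU + pD = A exp s + B exp (t - s) + C exp t - K]
    with [A = (1 - c / b) / a], [B = (1 - c / a) / b], [C = c / (a b)]. The
    hypothesis makes [A], [B] and [C] nonnegative, so the total power is jointly
    convex in [(s, t)] over a convex region. Hence the set of [t] at which some
    [s] satisfies [alpha (omega (pU + pD) + Pfix) <= Rtot] is convex for each
    [alpha > 0]. *)

Lemma is_max_sup (R : realType) (E : set R) (m : R) : is_max E m -> sup E = m.
Proof.
move=> [Em mE]; apply/eqP; rewrite eq_le ge_sup/=; [|by exists m|by []].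
by apply: ub_le_sup => //; exists m.
Qed.

Section PowerParametrization.
Variables (R : realType) (hU hD hUD chi W omega Pfix : R).
Hypotheses (hU_gt0 : 0 < hU) (hD_gt0 : 0 < hD) (hUD_ge0 : 0 <= hUD).
Hypotheses (chi_ge0 : 0 <= chi) (W_gt0 : 0 < W).
Hypotheses (omega_gt0 : 0 < omega) (Pfix_gt0 : 0 < Pfix).

(** [powU s] solves [rateU x = W * s / ln 2] for [x]. With that uplink power fixed, [powD s t] is
    the downlink power that supplies the remaining rate [W * (t - s) / ln 2]. *)
Definition powU (s : R) : R := (expR s - 1) * (1 + chi) / hU.

Definition powD (s t : R) : R :=
  (expR (t - s) - 1) * (1 + powU s * hUD) / hD.

Let chi1_gt0 : 0 < 1 + chi. Proof. by rewrite ltr_wpDr. Qed.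

Let ln2_gt0 : 0 < ln 2 :> R. Proof. by apply: ln_gt0; rewrite ltr1n. Qed.

Lemma powU_ge0 (s : R) : 0 <= s -> 0 <= powU s.
Proof.
move=> s0; rewrite /powU divr_ge0 ?(ltW hU_gt0)// mulr_ge0 ?(ltW chi1_gt0)//.
by rewrite subr_ge0 -expR0 ler_expR.
Qed.

Lemma interference_gt0 (x : R) : 0 <= x -> 0 < 1 + x * hUD.
Proof. by move=> x0; rewrite ltr_wpDr// mulr_ge0. Qed.

Lemma powD_ge0 (s t : R) : 0 <= s -> s <= t -> 0 <= powD s t.
Proof.
move=> s0 st; rewrite /powD divr_ge0 ?(ltW hD_gt0)//.
rewrite mulr_ge0 ?(ltW (interference_gt0 (powU_ge0 s0)))//.
by rewrite subr_ge0 -expR0 ler_expR subr_ge0.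
Qed.

Lemma feasible_pow (s beta : R) : 0 <= s -> s <= beta * ln 2 ->
  feasible hU hD hUD chi W (beta * W) (powU s, powD s (beta * ln 2)).
Proof.
move=> s0 st; split; [exact: powU_ge0|exact: powD_ge0|] => /=.
rewrite /rateU /rateD /log2.
have -> : 1 + powU s * hU / (1 + chi) = expR s.
  by rewrite /powU; field; rewrite !gt_eqF.
have -> : 1 + powD s (beta * ln 2) * hD / (1 + powU s * hUD)
    = expR (beta * ln 2 - s).
  rewrite /powD; field.
  by rewrite (gt_eqF hD_gt0) (gt_eqF (interference_gt0 (powU_ge0 s0))).
by rewrite !expRK; field; rewrite gt_eqF.
Qed.

(** The parameter is forced: [s = ln u], where [u] is one plus the uplink signal-to-noise ratio. The
    rate equation reads [ln u + ln v = beta * ln 2], and [u, v >= 1] because the powers are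
    nonnegative, whence [0 <= s <= beta * ln 2]. *)
Lemma feasible_powP (beta : R) (p : R * R) :
  feasible hU hD hUD chi W (beta * W) p ->
  exists s, [/\ 0 <= s, s <= beta * ln 2 &
                p = (powU s, powD s (beta * ln 2))].
Proof.
case: p => x y [/= x0 y0]; rewrite /rateU /rateD /log2.
set u := 1 + x * hU / _; set v := 1 + y * hD / _ => rE.
have d_gt0 := interference_gt0 x0.
have u1 : 1 <= u by rewrite lerDl divr_ge0 ?mulr_ge0// ltW.
have v1 : 1 <= v by rewrite lerDl divr_ge0 ?mulr_ge0// ltW.
have tE : ln u + ln v = beta * ln 2.
  apply: (mulfI (lt0r_neq0 W_gt0)); rewrite mulrA (mulrC W beta) -rE.
  by field; rewrite gt_eqF.
exists (ln u); rewrite -tE lerDl !ln_ge0//; split => //.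
have xE : powU (ln u) = x.
  rewrite /powU lnK ?posrE ?(lt_le_trans ltr01)// /u.
  by field; rewrite !gt_eqF.
rewrite /powD xE addrAC subrr add0r lnK ?posrE ?(lt_le_trans ltr01)//.
congr pair; rewrite /v; field.
by rewrite !gt_eqF.
Qed.

Let a := hU / (1 + chi).
Let A := (1 - hUD / hD) / a.
Let B := (1 - hUD / a) / hD.
Let C := hUD / (a * hD).

(** Interference couples the powers only through the product [expR s * expR (t - s)], which
    collapses to [expR t]. What remains is a combination of exponentials of linear forms in
    [(s, t)]. *)
Lemma total_powE (s t : R) :
  powU s + powD s t =
  A * expR s + B * expR (t - s) + C * expR t - (1 / a + B).
Proof.
have -> : expR t = expR s * expR (t - s) by rewrite -expRD addrC subrK.
by rewrite /powD /powU /A /B /C /a; field; rewrite !gt_eqF.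
Qed.

Hypothesis hUD_lt : hUD * (1 + chi) < Num.min hU hD.

(** The two halves of the minimum serve separately: [hUD < hD] gives [0 <= A], and
    [hUD * (1 + chi) < hU], that is [hUD < a], gives [0 <= B]. *)
Let hUD_lt_hD : hUD < hD.
Proof.
move: hUD_lt; rewrite lt_min => /andP[_]; apply: le_lt_trans.
by rewrite ler_peMr// lerDl.
Qed.

Let a_gt0 : 0 < a. Proof. exact: divr_gt0. Qed.

Let A_ge0 : 0 <= A.
Proof.
rewrite divr_ge0 ?(ltW a_gt0)// subr_ge0 ler_pdivrMr// mul1r.
exact: ltW.
Qed.

Let B_ge0 : 0 <= B.
Proof.
rewrite divr_ge0 ?(ltW hD_gt0)// subr_ge0 ler_pdivrMr// mul1r.
rewrite ler_pdivlMr//; move: hUD_lt; rewrite lt_min => /andP[+ _].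
exact: ltW.
Qed.

Let C_ge0 : 0 <= C.
Proof. by rewrite divr_ge0// mulr_ge0// ltW. Qed.

Lemma total_pow_convex (k : {i01 R}) (s1 t1 s2 t2 : R) :
  powU (k%:num * s1 + (1 - k%:num) * s2) +
  powD (k%:num * s1 + (1 - k%:num) * s2) (k%:num * t1 + (1 - k%:num) * t2) <=
    k%:num * (powU s1 + powD s1 t1) + (1 - k%:num) * (powU s2 + powD s2 t2).
Proof.
set s := k%:num * s1 + _; set t := k%:num * t1 + _; rewrite !total_powE.
have eC (x y : R) : expR (k%:num * x + (1 - k%:num) * y)
    <= k%:num * expR x + (1 - k%:num) * expR y by exact: convex_expR.
have tsE : t - s = k%:num * (t1 - s1) + (1 - k%:num) * (t2 - s2).
  by rewrite /t /s; ring.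
have hA := ler_wpM2l A_ge0 (eC s1 s2).
have hB := ler_wpM2l B_ge0 (eC (t1 - s1) (t2 - s2)).
have hC := ler_wpM2l C_ge0 (eC t1 t2).
rewrite tsE; apply: le_trans (lerB (lerD (lerD hA hB) hC) (lexx _)) _.
by rewrite le_eqVlt; apply/orP; left; apply/eqP; ring.
Qed.

Lemma total_pow_min (t : R) : 0 <= t ->
  exists s, [/\ 0 <= s, s <= t & forall s', 0 <= s' -> s' <= t ->
    powU s + powD s t <= powU s' + powD s' t].
Proof.
move=> t0.
(* For fixed [t] the other terms of [total_powE] are constant, so it suffices to minimize this part
   over the compact interval [[0, t]]. *)
have cont : continuous (fun s : R => A * expR s + B * expR (t - s)).
  move=> s; apply: cvgD; apply: cvgM; try exact: cvg_cst.
    exact: continuous_expR.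
  apply: (@continuous_comp _ _ _ (fun s : R => t - s) expR).
    by apply: cvgB; [exact: cvg_cst|exact: cvg_id].
  exact: continuous_expR.
have [s] := EVT_min t0 (continuous_subspaceT cont).
rewrite in_itv/= => /andP[s0 st] smin; exists s; split=> // s' s'0 s't.
by rewrite !total_powE !lerD2r; apply: smin; rewrite in_itv/= s'0.
Qed.

Local Notation EEv := (EE_values hU hD hUD chi W omega Pfix).

Let total_gt0 (q : R) : 0 <= q -> 0 < omega * q + Pfix.
Proof. by move=> q0; rewrite ltr_wpDl// mulr_ge0// ltW. Qed.

(** At a fixed rate the numerator is constant, so a pair of least total power maximizes the
    efficiency. *)
Lemma EE_values_max (Rtot : R) : 0 <= Rtot -> exists m, is_max (EEv Rtot) m.
Proof.
move=> R0; have RE : Rtot = Rtot / W * W by rewrite mulfVK ?gt_eqF.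
have b0 : 0 <= Rtot / W by rewrite divr_ge0// ltW.
rewrite RE; set beta := Rtot / W in b0 *.
have [|s [s0 st smin]] := @total_pow_min (beta * ln 2).
  by rewrite mulr_ge0// ltW.
exists (EE omega Pfix (beta * W) (powU s, powD s (beta * ln 2))); split.
  by exists (powU s, powD s (beta * ln 2)) => //; exact: feasible_pow.
move=> _ [p /feasible_powP[s' [s'0 s't ->]] <-].
rewrite /EE /=; apply: ler_wpM2l; first by rewrite mulr_ge0// ltW.
rewrite lef_pV2 ?posrE ?total_gt0 ?addr_ge0 ?powU_ge0 ?powD_ge0//.
by rewrite lerD2r ler_pM2l// smin.
Qed.

Lemma max_EEP (Rtot : R) : 0 <= Rtot ->
  is_max (EEv Rtot) (max_EE hU hD hUD chi W omega Pfix Rtot).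
Proof. by move=> /EE_values_max[m mM]; rewrite /max_EE (is_max_sup mM). Qed.

(** Since the maximum is attained, a superlevel set is the projection to [beta] of a set of pairs
    [(beta, s)]; clearing the positive denominator leaves a condition convex in the pair when
    [alpha > 0]. *)
Lemma max_EE_ge (alpha beta : R) : 0 <= beta ->
  alpha <= max_EE hU hD hUD chi W omega Pfix (beta * W) <->
  exists s, [/\ 0 <= s, s <= beta * ln 2 &
    alpha * (omega * (powU s + powD s (beta * ln 2)) + Pfix) <= beta * W].
Proof.
move=> b0; have bW0 : 0 <= beta * W by rewrite mulr_ge0// ltW.
have [[p fp pE] ub] := max_EEP bW0; split=> [|[s [s0 st sa]]].
  rewrite -pE; have [s [s0 st ->]] := feasible_powP fp.
  rewrite /EE /= ler_pdivlMr ?total_gt0 ?addr_ge0 ?powU_ge0 ?powD_ge0//.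
  by exists s.
apply: le_trans (ub _ (ex_intro2 _ _ _ (feasible_pow s0 st) erefl)).
by rewrite /EE /= ler_pdivlMr ?total_gt0 ?addr_ge0 ?powU_ge0 ?powD_ge0.
Qed.

Lemma max_EE_ge0 (Rtot : R) : 0 <= Rtot ->
  0 <= max_EE hU hD hUD chi W omega Pfix Rtot.
Proof.
move=> R0; have [[p [p0 q0 _] <-] _] := max_EEP R0.
by rewrite /EE divr_ge0// ltW// total_gt0// addr_ge0.
Qed.

Lemma quasi_concave_max_EE :
  quasi_concave ([set betaSE : R^o | 0 <= betaSE])
    (fun betaSE : R^o => max_EE hU hD hUD chi W omega Pfix (betaSE * W)).
Proof.
move=> alpha b1 b2 k; rewrite !inE => -[/= b1_ge0 m1] [/= b2_ge0 m2].
set b : R := k%:num * b1 + (1 - k%:num) * b2.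
change (0 <= b /\ alpha <= max_EE hU hD hUD chi W omega Pfix (b * W)).
have k0 : 0 <= k%:num :> R by [].
have k'0 : 0 <= (1 - k%:num) :> R by [].
have b_ge0 : 0 <= b by rewrite addr_ge0// mulr_ge0.
(* For [alpha <= 0] the superlevel set is the whole half-line; otherwise the convexity inequality
   may be multiplied by [alpha]. *)
split=> //; have [alpha_le0|alpha_gt0] := leP alpha 0.
  by apply: (le_trans alpha_le0); rewrite max_EE_ge0// mulr_ge0// ltW.
have [s1 [s1_ge0 s1t e1]] := (max_EE_ge alpha b1_ge0).1 m1.
have [s2 [s2_ge0 s2t e2]] := (max_EE_ge alpha b2_ge0).1 m2.
(* The rate splits are mixed with the same weights as the total rates, as joint convexity
   requires. *)
apply/(max_EE_ge alpha b_ge0); exists (k%:num * s1 + (1 - k%:num) * s2).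
have tE : b * ln 2 = k%:num * (b1 * ln 2) + (1 - k%:num) * (b2 * ln 2).
  by rewrite /b; ring.
split; first by rewrite addr_ge0// mulr_ge0.
  by rewrite tE lerD// ler_wpM2l.
have conv := total_pow_convex k s1 (b1 * ln 2) s2 (b2 * ln 2).
rewrite tE; have := lerD (ler_wpM2l k0 e1) (ler_wpM2l k'0 e2).
have -> : k%:num * (b1 * W) + (1 - k%:num) * (b2 * W) = b * W by rewrite /b; ring.
apply: le_trans.
have := lerD (ler_wpM2l (ltW omega_gt0) conv) (lexx Pfix).
move=> /(ler_wpM2l (ltW alpha_gt0)) /le_trans; apply.
by rewrite le_eqVlt; apply/orP; left; apply/eqP; ring.
Qed.

End PowerParametrization.

Theorem theorem3 (R : realType) (hU hD hUD chi W omega Pfix : R)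
    (hU_gt0 : 0 < hU) (hD_gt0 : 0 < hD) (hUD_ge0 : 0 <= hUD)
    (chi_ge0 : 0 <= chi) (W_gt0 : 0 < W) (omega_gt0 : 0 < omega)
    (Pfix_gt0 : 0 < Pfix)
    (hUD_lt : hUD * (1 + chi) < Num.min hU hD) :
  (forall Rtot : R, 0 <= Rtot ->
     is_max (EE_values hU hD hUD chi W omega Pfix Rtot)
            (max_EE hU hD hUD chi W omega Pfix Rtot)) /\
  quasi_concave ([set betaSE : R^o | 0 <= betaSE])
    (fun betaSE : R^o => max_EE hU hD hUD chi W omega Pfix (betaSE * W)).
Proof.
split; [by move=> Rtot; exact: max_EEP|exact: quasi_concave_max_EE].
Qed.
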